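(* Let $0<a\le b\le2$, let $\alpha:\mathbf{R}\to[a,b]$ be continuous, let $0<H<1$, $\lambda>0$, and let $X_{H,\alpha(x),\lambda}$ be the linear tempered fractional multistable motion. There are two positive numbers $c$ and $C$, depending only on $a,b,\lambda$ and $H$, such that $$c\,|t-v|^{Hb/a}\le\Big\|X_{H,\alpha(x),\lambda}(t)-X_{H,\alpha(x),\lambda}(v)\Big\|_\alpha\le C\,|t-v|^{Ha/b}$$ for all $t,v\in\mathbf{R}$ satisfying $|t-v|\le1$.
   Context: Conventions: $(x)_+=\max\{x,0\}$ and $0^\gamma=0$ for all $\gamma\in\mathbf{R}$. Set $$G_{H,\alpha(x),\lambda}(t,x)=e^{-\lambda(t-x)_+}(t-x)_+^{H-\frac1{\alpha(x)}}-e^{-\lambda(-x)_+}(-x)_+^{H-\frac1{\alpha(x)}} .$$ The LTFmSM is the multistable stochastic integral $X_{H,\alpha(x),\lambda}(t)=\int_{-\infty}^\infty G_{H,\alpha(x),\lambda}(t,x)\,dM_\alpha(x)$, $t\in\mathbf{R}$, i.e. the process with $$\mathbf{E}\Big[e^{i\sum_{k=1}^d\theta_kX_{H,\alpha(x),\lambda}(t_k)}\Big]=\exp\Big\{-\int_{-\infty}^\infty\Big|\sum_{k=1}^d\theta_kG_{H,\alpha(x),\lambda}(t_k,x)\Big|^{\alpha(x)}dx\Big\}.$$ For a random variable $\int f\,dM_\alpha$ given as a multistable integral of a measurable $f$ with $\int_{-\infty}^\infty|f(x)|^{\alpha(x)}dx<\infty$, its quasi norm $\|\int f\,dM_\alpha\|_\alpha$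 is the number $y>0$ such that $\int_{-\infty}^\infty|f(x)/y|^{\alpha(x)}dx=1$ (and $0$ if $f=0$ a.e.). In particular $\|X_{H,\alpha(x),\lambda}(t)-X_{H,\alpha(x),\lambda}(v)\|_\alpha$ is this quantity for $f(x)=G_{H,\alpha(x),\lambda}(t,x)-G_{H,\alpha(x),\lambda}(v,x)$. *)

(* Defs.v *)
From mathcomp Require Import all_boot all_order all_algebra.
From mathcomp Require Import complex.
From mathcomp Require Import all_classical all_reals all_analysis.

Set Implicit Arguments.
Unset Strict Implicit.
Unset Printing Implicit Defensive.

Import Order.TTheory GRing.Theory Num.Theory.
Import numFieldNormedType.Exports.

Local Open Scope classical_set_scope.
Local Open Scope ring_scope.

Definition pos_part {R : realType} (x : R) : R := Num.max x 0.

(* Power with the convention 0 ^ gamma = 0 for every real gamma; it differs from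
   powR at gamma = 0, where 0 `^ 0 = 1. *)
Definition pow0 {R : realType} (x gamma : R) : R :=
  if x == 0 then 0 else x `^ gamma.

Definition ltfmsm_kernel {R : realType} (H lambda : R) (alpha : R -> R)
    (t x : R) : R :=
  expR (- lambda * pos_part (t - x)) * pow0 (pos_part (t - x)) (H - (alpha x)^-1)
  - expR (- lambda * pos_part (- x)) * pow0 (pos_part (- x)) (H - (alpha x)^-1).

Definition modular {R : realType} (alpha : R -> R) (f : R -> R) : \bar R :=
  (\int[lebesgue_measure]_x (`|f x| `^ alpha x)%:E)%E.

(* E[exp(i Y)] = E[cos Y] + i E[sin Y]. *)
Definition mean_expi {R : realType} {d : measure_display}
    {Omega : measurableType d} (P : probability Omega R) (Y : Omega -> R) : R[i] :=
  Complex (\int[P]_w cos (Y w)) (\int[P]_w sin (Y w)).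

(* exp(- int |f(x)|^alpha(x) dx), equal to 0 when the integral diverges. *)
Definition multistable_cf {R : realType} (alpha : R -> R) (f : R -> R) : R[i] :=
  (fine (expeR (- modular alpha f)%E))%:C%C.

(* Y = int f dM_alpha.  As multistable integrals are determined through their
   characteristic functions, this is a condition on the law of Y. *)
Definition is_multistable_integral {R : realType} {d : measure_display}
    {Omega : measurableType d} (P : probability Omega R) (alpha : R -> R)
    (f : R -> R) (Y : Omega -> R) : Prop :=
  [/\ measurable_fun setT Y, measurable_fun setT f,
      (modular alpha f < +oo)%E &
      forall theta : R, mean_expi P (fun w => theta * Y w) =
                        multistable_cf alpha (fun x => theta * f x)].

Definition is_ltfmsm {R : realType} {d : measure_display}
    {Omega : measurableType d} (P : probability Omega R) (H lambda : R)
    (alpha : R -> R) (X : R -> {RV P >-> R}) : Prop :=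
  forall (n : nat) (theta t : 'I_n -> R),
    mean_expi P (fun w => \sum_(k < n) theta k * X (t k) w) =
    multistable_cf alpha
      (fun x => \sum_(k < n) theta k * ltfmsm_kernel H lambda alpha (t k) x).

(* When f = 0 a.e. no y qualifies and the value is the default 0. *)
Definition integrand_quasi_norm {R : realType} (alpha f : R -> R) : R :=
  xget 0 [set y : R | 0 < y /\ modular alpha (fun x => f x / y) = 1%E].

(* The choice of the representing f is immaterial: for y > 0, the condition
   modular alpha (f / y) = 1 says that the characteristic function of Y takes
   the value exp(-1) at 1 / y. *)
Definition quasi_norm {R : realType} {d : measure_display}
    {Omega : measurableType d} (P : probability Omega R) (alpha : R -> R)
    (Y : Omega -> R) : R :=
  xget 0 [set y : R | exists2 f : R -> R,
    is_multistable_integral P alpha f Y & y = integrand_quasi_norm alpha f].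

(* Main.v *)
Require Import Defs.
From mathcomp Require Import all_boot all_order all_algebra.
From mathcomp Require Import all_classical all_reals all_analysis.
From mathcomp Require Import measurable_realfun ring lra.

Set Implicit Arguments.
Unset Strict Implicit.
Unset Printing Implicit Defensive.

Import Order.TTheory GRing.Theory Num.Theory.
Import numFieldNormedType.Exports.

Local Open Scope classical_set_scope.
Local Open Scope ring_scope.

(** Let g = G(t, .) - G(v, .), with h = t - v in ]0, 1], and let phi(y) be the
modular of g / y. The quasi norm is the solution of phi(y) = 1, so it lies
between any y1 and y2 with phi(y1) > 1 > phi(y2).
For the upper bound, |g(x)|^alpha(x) is at most a multiple of
(t - x)^(H a - 1) and (v - x)^(H a - 1) near t and v, and at most a multiple of
h^a (v - x)^(- (1 - H) a - 1) for v - x >= h; hence the modular of g is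
O(h^(H a)), and y2 = C h^(H a / b) works for C large.
For the lower bound, only the interval [v, v + h / 2] is needed, where g is the
single term exp (- lambda (t - x)) (t - x)^(H - 1 / alpha(x)); there
y1 = c h^(H b / a) works for c small. *)

(** * The modular of f / y as a function of y, and how it locates the quasi norm *)

Section modular.
Context {R : realType}.
Local Notation mu := (@lebesgue_measure R).

Lemma measurable_fun_powR_var (f g : R -> R) :
  measurable_fun setT f -> measurable_fun setT g ->
  measurable_fun setT (fun x => f x `^ g x).
Proof.
move=> mf mg; rewrite /powR; apply: measurable_fun_ifT.
- exact: measurable_fun_eqr.
- have m1 : measurable_fun [set: bool] (fun c : bool => c%:R : R) by [].
  by apply: (measurableT_comp m1); exact: measurable_fun_eqr.
- apply: measurableT_comp; first exact: measurable_expR.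
  apply: measurable_funM => //.
  by apply: measurableT_comp => //; exact: measurable_ln.
Qed.

Context (alpha : R -> R) (a b : R).
Hypotheses (malpha : measurable_fun setT alpha) (a_gt0 : 0 < a)
  (alphaab : forall x, a <= alpha x <= b).

Lemma measurable_modular_integrand (f : R -> R) : measurable_fun setT f ->
  measurable_fun setT (fun x => (`|f x| `^ alpha x)%:E).
Proof.
move=> mf; apply/measurable_EFinP; apply: measurable_fun_powR_var => //.
exact: measurableT_comp.
Qed.

Lemma modular_ge0 (f : R -> R) : (0 <= modular alpha f)%E.
Proof. by apply: integral_ge0 => x _; rewrite lee_fin powR_ge0. Qed.

Context (f : R -> R).
Hypothesis mf : measurable_fun setT f.

Let mfdiv (y : R) : measurable_fun setT (fun x => f x / y).
Proof. by apply: measurable_funM. Qed.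

Lemma exponent_gt0 x : 0 < alpha x.
Proof. by have /andP[/(lt_le_trans a_gt0)] := alphaab x. Qed.

Lemma le_modular_div (y z : R) : 0 < y -> y <= z ->
  (modular alpha (fun x => f x / z)%R <= modular alpha (fun x => f x / y)%R)%E.
Proof.
move=> y0 yz; have z0 := lt_le_trans y0 yz.
apply: ge0_le_integral => //.
- exact: (measurable_modular_integrand (mfdiv z)).
- exact: (measurable_modular_integrand (mfdiv y)).
move=> x _; rewrite lee_fin; apply: ge0_ler_powR.
- exact/ltW/exponent_gt0.
- by rewrite nnegrE.
- by rewrite nnegrE.
rewrite !normrM ler_wpM2l// !gtr0_norm ?invr_gt0//.
by rewrite lef_pV2.
Qed.

(** Pointwise, f / y is r times f / (r y), and r ^ alpha(x) <= r ^ b since r >= 1. This quantitative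
    estimate plays the part of continuity in y. *)
Lemma modular_div_le_scale (r y : R) : 1 <= r -> 0 < y ->
  (modular alpha (fun x => f x / y)%R <=
   (r `^ b)%:E * modular alpha (fun x => f x / (r * y))%R)%E.
Proof.
move=> r1 y0; have r0 : 0 < r := lt_le_trans ltr01 r1.
rewrite /modular -ge0_integralZl_EFin ?powR_ge0//; last first.
  exact: (measurable_modular_integrand (mfdiv (r * y))).
apply: ge0_le_integral => //.
- exact: (measurable_modular_integrand (mfdiv y)).
- apply: measurable_funeM.
  exact: (measurable_modular_integrand (mfdiv (r * y))).
move=> x _; rewrite -EFinM lee_fin.
rewrite (_ : f x / y = r * (f x / (r * y))); last first.
  by field; rewrite !gt_eqF.
rewrite normrM powRM// ler_wpM2r ?powR_ge0// gtr0_norm//.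
by apply: ler_powR => //; have /andP[] := alphaab x.
Qed.

(* phi y = modular (f / y) is nonincreasing and phi y <= r ^ b phi (r y), so it
   is continuous and takes the value 1 at the infimum of {phi <= 1}. *)
Lemma integrand_quasi_norm_itv (y1 y2 : R) : 0 < y1 -> 0 < y2 ->
  (1 < modular alpha (fun x => f x / y1)%R)%E ->
  (modular alpha (fun x => f x / y2)%R < 1)%E ->
  y1 <= integrand_quasi_norm alpha f <= y2.
Proof.
move=> y10 y20; set phi := fun y => modular alpha (fun x => f x / y).
rewrite -/(phi y1) -/(phi y2) => phi1 phi2.
have b0 : 0 < b by have /andP[/(lt_le_trans a_gt0)/lt_le_trans h /h] := alphaab 0.
have mono y z : 0 < y -> y <= z -> (phi z <= phi y)%E by exact: le_modular_div.
have lowb y : 0 < y -> (phi y <= 1)%E -> y1 <= y.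
  move=> y0 phiy; rewrite leNgt; apply/negP => /ltW /(mono _ _ y0) h.
  by have := lt_le_trans phi1 (le_trans h phiy); rewrite ltxx.
suff [y0 Py0] : exists y, 0 < y /\ phi y = 1%E.
  have [q0 phiq] := xgetPex 0 (ex_intro (fun y => 0 < y /\ phi y = 1%E) _ Py0).
  rewrite -/(integrand_quasi_norm alpha f) in q0 phiq *.
  apply/andP; split; first by apply: lowb => //; rewrite phiq.
  rewrite leNgt; apply/negP => /ltW /(mono _ _ y20) h.
  by have := le_lt_trans h phi2; rewrite phiq ltxx.
pose S := [set y : R | 0 < y /\ (phi y <= 1)%E].
have S2 : S y2 by split => //; exact: ltW.
have Sinf : has_inf S.
  by split; [exists y2|exists y1 => y [yp hy]; exact: lowb].
pose ys := inf S.
have ys1 : y1 <= ys.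
  by apply: lb_le_inf; [exists y2|move=> y [yp hy]; exact: lowb].
have ys0 : 0 < ys := lt_le_trans y10 ys1.
exists ys; split => //.
have rootb q : 1 < q -> exists2 r : R, 1 < r & r `^ b = q.
  move=> q1; exists (q `^ b^-1); last first.
    by rewrite -powRrM mulVf ?gt_eqF// powRr1// ltW// (lt_trans _ q1).
  rewrite -[ltLHS](powRr0 q) /powR gt_eqF ?(lt_trans _ q1)// mul0r expR0.
  by rewrite expR_gt1 mulr_gt0 ?invr_gt0// ln_gt0.
(* For r > 1 the point r ys lies above the infimum, hence above some y in [S]; so phi (r ys) <= 1
   and phi ys <= r ^ b, where r ^ b is any prescribed q > 1. *)
have phi_le q : 1 < q -> (phi ys <= q%:E)%E.
  move=> /rootb[r r1 <-].
  apply: le_trans (modular_div_le_scale (ltW r1) ys0) _.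
  rewrite -[leRHS]mule1 lee_wpmul2l ?lee_fin ?powR_ge0//.
  have e0 : 0 < (r - 1) * ys by rewrite mulr_gt0// subr_gt0.
  have [y [yp hy] yr] := inf_adherent e0 Sinf.
  apply: le_trans hy; apply: mono => //; apply: ltW; apply: lt_le_trans yr _.
  by rewrite -/ys; lra.
have phile1 : (phi ys <= 1)%E.
  apply/lee_addgt0Pr => e e0; rewrite -EFinD; apply: phi_le; lra.
apply/eqP; rewrite eq_le phile1/= leNgt; apply/negP => philt1.
have finphi : phi ys \is a fin_num.
  by rewrite ge0_fin_numE ?modular_ge0// (lt_trans philt1)// ltry.
move: philt1; rewrite -(fineK finphi); set p := fine (phi ys) => philt1.
have p0 : 0 <= p by rewrite fine_ge0// modular_ge0.
have p1 : p < 1 by rewrite lte_fin in philt1.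
(* If phi ys = p < 1, the factor 2 / (1 + p) exceeds 1 but its product with p is still at most 1;
   hence ys / r would be a point of [S] below the infimum. *)
have [r r1 rb] : exists2 r : R, 1 < r & r `^ b = 2 / (1 + p).
  by apply: rootb; rewrite ltr_pdivlMr; lra.
have r0 : 0 < r by rewrite (lt_trans _ r1).
have Sr : S (ys / r).
  split; first by rewrite divr_gt0.
  apply: le_trans (modular_div_le_scale (ltW r1) (divr_gt0 ys0 r0)) _.
  rewrite mulrCA mulfV ?gt_eqF// mulr1 -/(phi ys) -(fineK finphi) -/p rb.
  rewrite -EFinM lee_fin mulrAC ler_pdivrMr; lra.
have := ge_inf (proj2 Sinf) Sr; rewrite -/ys leNgt => /negP; apply.
by rewrite ltr_pdivrMr// ltr_pMr.
Qed.

End modular.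

(** * From the law of an increment to the quasi norm of its integrand *)

Section quasi_norm.
Context {R : realType} (alpha : R -> R).

(** The modular lies in [0, +oo], where exp(- m) is finite and injective, the value 0 standing for m
    = +oo; so [fine] loses nothing. *)
Lemma multistable_cf_inj (f g : R -> R) :
  multistable_cf alpha f = multistable_cf alpha g ->
  modular alpha f = modular alpha g.
Proof.
have fin h : expeR (- modular alpha h)%E \is a fin_num.
  rewrite ge0_fin_numE ?expeR_ge0// ltey expeR_eqy.
  by case: (modular alpha h) (modular_ge0 alpha h).
rewrite /multistable_cf => -[] e.
apply: oppe_inj; apply: expeR_inj.
by rewrite -(fineK (fin f)) e fineK.
Qed.

Context {d : measure_display} {Omega : measurableType d}
  (P : probability Omega R).

(** Two integrands representing Y share its characteristic function at 1 / y, so f / y and g / y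
    have equal modulars for every y, and the sets defining the two quasi norms coincide. *)
Lemma quasi_norm_integrand (f : R -> R) (Y : Omega -> R) :
  is_multistable_integral P alpha f Y ->
  quasi_norm P alpha Y = integrand_quasi_norm alpha f.
Proof.
move=> fY; have eqn g : is_multistable_integral P alpha g Y ->
    integrand_quasi_norm alpha g = integrand_quasi_norm alpha f.
  move=> gY; congr xget; apply/seteqP.
  suff e y : modular alpha (fun x => f x / y) = modular alpha (fun x => g x / y).
    by split => y /= [y0]; rewrite e.
  have swap h : (fun x : R => h x / y) = (fun x => y^-1 * h x).
    by apply/funext => x; rewrite mulrC.
  rewrite !swap; apply: multistable_cf_inj.
  by case: fY gY => _ _ _ <- [_ _ _ <-].
rewrite /quasi_norm; set S := [set y | _].
have : S (integrand_quasi_norm alpha f) by exists f.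
by case/(xgetI 0) => g gY ->; exact: eqn.
Qed.

Lemma ltfmsm_increment_integral (H lambda : R) (X : R -> {RV P >-> R}) (t v : R) :
  is_ltfmsm H lambda alpha X ->
  let g x := ltfmsm_kernel H lambda alpha t x -
             ltfmsm_kernel H lambda alpha v x in
  measurable_fun setT g -> (modular alpha g < +oo)%E ->
  is_multistable_integral P alpha g (X t \- X v).
Proof.
move=> HX g mg gfin; split=> // theta.
(* Two times with weights theta and - theta turn the joint characteristic function into that of the
   increment. *)
have := HX 2 (fun k => if k == ord0 then theta else - theta)
  (fun k => if k == ord0 then t else v).
under eq_fun do rewrite !big_ord_recl big_ord0 /= addr0 mulNr -mulrBr.
move=> ->; congr multistable_cf; apply/funext => x.
by rewrite !big_ord_recl big_ord0 /= addr0 mulNr -mulrBr.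
Qed.

End quasi_norm.

(** * Integrals of powers of z - x near the singularity and at minus infinity *)

Section power_integrals.
Context {R : realType}.
Local Notation mu := (@lebesgue_measure R).

Lemma is_derive_powR_sub (z p x : R) : x < z ->
  is_derive x 1 (fun x => (z - x) `^ p) (- (p * (z - x) `^ (p - 1))).
Proof.
move=> xz; have z0 : 0 < z - x by rewrite subr_gt0.
have dz : is_derive x 1 (fun x => z - x) (- 1).
  by apply: is_derive_eq; rewrite add0r mul1r.
have := @is_derive1_comp R (fun y => y `^ p) (fun x => z - x) x _ _
  (is_derive1_powR p z0) dz.
by rewrite mulrN1.
Qed.

Lemma measurable_powR_sub (z p : R) (D : set R) :
  measurable_fun D (fun x => ((z - x) `^ p)%:E).
Proof.
apply: measurable_funTS; apply/measurable_EFinP.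
apply: (measurableT_comp (measurable_powR p)).
exact: measurable_funB.
Qed.

Lemma integral_powR_sub (z p u w : R) : p != 0 -> u < w -> w < z ->
  (\int[mu]_(x in `[u, w]) ((z - x) `^ (p - 1))%:E =
   (((z - u) `^ p - (z - w) `^ p) / p)%:E)%E.
Proof.
move=> p0 uw wz.
pose F x := - ((z - x) `^ p / p).
have dF x : x < z -> is_derive x 1 F ((z - x) `^ (p - 1)).
  move=> xz; have h := is_derive_powR_sub p xz.
  rewrite /F; apply: is_derive_eq.
  by rewrite /GRing.scale /=; field.
have ctsF x : x < z -> {for x, continuous F}.
  move=> xz; apply/differentiable_continuous/derivable1_diffP.
  exact: (@ex_derive _ _ _ _ _ _ _ (dF x xz)).
rewrite (@continuous_FTC2 _ _ F)//.
- by rewrite -EFinB /F; congr EFin; field.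
- apply: derivable_within_continuous => x; rewrite in_itv/= => /andP[_ xw].
  exact: (@ex_derive _ _ _ _ _ _ _ (is_derive_powR_sub _ (le_lt_trans xw wz))).
- split.
  + move=> x; rewrite in_itv/= => /andP[_ xw].
    exact: (@ex_derive _ _ _ _ _ _ _ (dF x (lt_trans xw wz))).
  + by apply: cvg_at_right_filter; apply: ctsF; apply: lt_trans wz.
  + by apply: cvg_at_left_filter; apply: ctsF.
move=> x; rewrite in_itv/= => /andP[_ xw].
rewrite derive1E; exact: (@derive_val _ _ _ _ _ _ _ (dF x (lt_trans xw wz))).
Qed.

(** The fundamental theorem of calculus applies on each compact interval left of z; monotone
    convergence carries a uniform bound to their union. This serves both the singular end z and the
    unbounded end. *)
Lemma integral_powR_sub_bigcup_le (z p K : R) (u w : R^nat) : p != 0 ->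
  nonincreasing_seq u -> nondecreasing_seq w ->
  (forall n, u n < w n) -> (forall n, w n < z) ->
  (forall n, ((z - u n) `^ p - (z - w n) `^ p) / p <= K) ->
  (\int[mu]_(x in \bigcup_n `[u n, w n]%classic) ((z - x) `^ (p - 1))%:E <= K%:E)%E.
Proof.
move=> p0 nu nw uw wz hK.
rewrite -(cvg_lim _ (ge0_nondecreasing_set_cvg_integral _ _ _ _))//.
- apply: lime_le.
    apply: ereal_nondecreasing_is_cvgn.
    apply: ge0_nondecreasing_set_nondecreasing_integral => //.
    + move=> m n mn; apply/subsetPset => x; rewrite /= !in_itv/= => /andP[ux xw].
      by rewrite (le_trans (nu _ _ mn) ux) (le_trans xw (nw _ _ mn)).
    + by move=> n; exact: measurable_powR_sub.
    + by move=> n x _; rewrite lee_fin powR_ge0.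
  by apply: nearW => n; rewrite integral_powR_sub// lee_fin.
- move=> m n mn; apply/subsetPset => x; rewrite /= !in_itv/= => /andP[ux xw].
  by rewrite (le_trans (nu _ _ mn) ux) (le_trans xw (nw _ _ mn)).
- by move=> n; exact: measurable_powR_sub.
- by move=> n x _; rewrite lee_fin powR_ge0.
Qed.

Lemma integral_powR_sub_left_le (z p l : R) : 0 < p -> 0 < l ->
  (\int[mu]_(x in `[(z - l)%R, z[) ((z - x) `^ (p - 1))%:E <= (l `^ p / p)%:E)%E.
Proof.
move=> p0 l0.
have pos n : 0 < n.+2%:R^-1 :> R by rewrite invr_gt0.
have lt1 n : n.+2%:R^-1 < 1 :> R by rewrite invf_lt1 ?ltr1n.
(* With [n.+2] the right end point is strictly beyond z - l already at n = 0, so no interval of the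
   exhaustion is degenerate. *)
rewrite (_ : `[z - l, z[%classic =
    \bigcup_n `[z - l, z - l * n.+2%:R^-1]%classic); last first.
  apply/seteqP; split => [x|x [n _]]; rewrite /= !in_itv/= => /andP[lx xz].
    have := @archi_boundP R (l / (z - x)).
    set n := Num.bound _ => hn; exists n => //=; rewrite in_itv/= lx/=.
    have zx : 0 < z - x by rewrite subr_gt0.
    rewrite lerBrDr -lerBrDl ler_pdivrMr//.
    have {hn} : l / (z - x) < n%:R by apply: hn; rewrite divr_ge0// ltW.
    rewrite ltr_pdivrMr// mulrC => /ltW/le_trans; apply.
    by rewrite ler_pM2l// ler_nat -addn2 leq_addr.
  by rewrite lx/=; apply: le_lt_trans xz _; rewrite ltrBlDr ltrDl mulr_gt0.
apply: integral_powR_sub_bigcup_le => //.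
- by rewrite gt_eqF.
- move=> m n mn; rewrite lerD2l lerN2 ler_pM2l// lef_pV2 ?posrE// ler_nat.
  by rewrite !ltnS.
- by move=> n; rewrite ltrD2l ltrN2 gtr_pMr.
- by move=> n; rewrite ltrBlDr ltrDl mulr_gt0.
move=> n; rewrite subKr ler_wpM2r ?invr_ge0 ?(ltW p0)//.
by rewrite lerBlDr lerDl powR_ge0.
Qed.

(** The antiderivative formula is used with the negative exponent p = - q; dividing by - q exchanges
    the two boundary terms, and the far one is dropped. *)
Lemma integral_powR_sub_tail_le (z q l : R) : 0 < q -> 0 < l ->
  (\int[mu]_(x in `]-oo, (z - l)%R]) ((z - x) `^ (- q - 1))%:E <=
   (l `^ (- q) / q)%:E)%E.
Proof.
move=> q0 l0.
rewrite (_ : `]-oo, z - l]%classic =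
    \bigcup_n `[z - l - n.+1%:R, z - l]%classic); last first.
  apply/seteqP; split => [x|x [n _]]; rewrite /= !in_itv/=; last by case/andP.
  move=> xz; have := @archi_boundP R (z - l - x).
  set n := Num.bound _ => hn; exists n => //=; rewrite in_itv/= xz andbT.
  have {hn} /ltW : z - l - x < n%:R by apply: hn; rewrite subr_ge0.
  by rewrite -natr1 => h; lra.
apply: integral_powR_sub_bigcup_le => //.
- by rewrite oppr_eq0 gt_eqF.
- by move=> m n mn; rewrite lerD2l lerN2 ler_nat.
- by move=> n; rewrite ltrBlDr ltrDl.
- by move=> n; rewrite ltrBlDr ltrDl.
move=> n; rewrite subKr invrN mulrN -mulNr opprB.
rewrite ler_wpM2r ?invr_ge0 ?(ltW q0)//.
by rewrite lerBlDr lerDl powR_ge0.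
Qed.

End power_integrals.

(** * Pointwise bounds for one term of the kernel *)

Section tempered_power.
Context {R : realType} (H lambda : R).
Hypotheses (H_gt0 : 0 < H) (H_lt1 : H < 1) (lambda_gt0 : 0 < lambda).

(** A single term of the kernel, as a function of the lag s = t - x with the exponent gamma = H - 1
    / alpha(x) frozen. *)
Definition tempered_power (gamma s : R) : R :=
  expR (- lambda * pos_part s) * pow0 (pos_part s) gamma.

Lemma tempered_power0 gamma s : s <= 0 -> tempered_power gamma s = 0.
Proof.
by move=> s0; rewrite /tempered_power /pos_part max_r// /pow0 eqxx mulr0.
Qed.

Lemma tempered_powerE gamma s : 0 < s ->
  tempered_power gamma s = expR (- lambda * s) * s `^ gamma.
Proof.
by move=> s0; rewrite /tempered_power /pos_part max_l ?ltW// /pow0 gt_eqF.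
Qed.

Lemma tempered_power_ge0 gamma s : 0 <= tempered_power gamma s.
Proof.
have [s0|s0] := leP s 0; first by rewrite tempered_power0.
by rewrite tempered_powerE// mulr_ge0 ?expR_ge0 ?powR_ge0.
Qed.

(** For e = H > 0 the resulting exponent exceeds -1 whatever A is: the singularity of the kernel
    becomes integrable after raising to the power alpha(x). *)
Lemma powR_sub_invM (s A e : R) : 0 < A -> (s `^ (e - A^-1)) `^ A = s `^ (e * A - 1).
Proof. by move=> A0; rewrite -powRrM mulrBl mulVf// gt_eqF. Qed.

Context (a b A : R).
Hypotheses (a_gt0 : 0 < a) (aA : a <= A) (Ab : A <= b) (b_le2 : b <= 2).

Let A_gt0 : 0 < A := lt_le_trans a_gt0 aA.
Let gamma := H - A^-1.

(** The exponential is at most 1, and replacing A by a in the exponent costs s ^ (H (A - a)) <= 2 ^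
    2. The range s <= 2 covers lags up to 2 h. *)
Lemma tempered_power_upper s : 0 < s -> s <= 2 ->
  tempered_power gamma s `^ A <= 4 * s `^ (H * a - 1).
Proof.
move=> s0 s2; rewrite tempered_powerE//.
have s_ge0 : 0 <= s by exact: ltW.
apply: (@le_trans _ _ ((s `^ gamma) `^ A)).
  apply: ge0_ler_powR; rewrite ?nnegrE ?powR_ge0 ?(ltW A_gt0)//.
    by rewrite mulr_ge0 ?expR_ge0 ?powR_ge0.
  by rewrite ler_piMl ?powR_ge0// expR_le1 mulNr oppr_le0 mulr_ge0// ltW.
rewrite powR_sub_invM// (_ : H * A - 1 = H * (A - a) + (H * a - 1)); last by ring.
rewrite powRD; last by apply/implyP => _; rewrite gt_eqF.
rewrite ler_wpM2r ?powR_ge0//.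
have e0 : 0 <= H * (A - a) by rewrite mulr_ge0 ?subr_ge0// ltW.
apply: (@le_trans _ _ (2 `^ (H * (A - a)))).
  by apply: ge0_ler_powR => //; rewrite nnegrE.
apply: (@le_trans _ _ (2 `^ 2%:R)).
  apply: ler_powR; first lra.
  rewrite -[leRHS]mul1r ler_pM ?subr_ge0 ?(ltW H_gt0) ?(ltW H_lt1)//.
  by move: a_gt0 Ab b_le2; lra.
by rewrite powR_mulrn//; lra.
Qed.

(** Here A s <= 2 bounds the tempering factor from below, and s <= 1 allows A to be replaced by b in
    the exponent. *)
Lemma tempered_power_lower s : 0 < s -> s <= 1 ->
  expR (- (2 * lambda)) * s `^ (H * b - 1) <= tempered_power gamma s `^ A.
Proof.
move=> s0 s1; rewrite tempered_powerE// powRM ?expR_ge0 ?powR_ge0//.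
rewrite powR_sub_invM// ler_pM ?expR_ge0 ?powR_ge0//.
  rewrite -expRM ler_expR mulNr mulNr lerN2.
  rewrite -mulrA mulrC ler_pM2r//.
  rewrite mulrC -[leRHS]mulr1 ler_pM ?(ltW s0) ?(ltW A_gt0)//.
  exact: le_trans b_le2.
by apply: ger_powR; [rewrite s0 s1|rewrite lerD2r ler_pM2l].
Qed.

Lemma expR_ge1 (x : R) : (1 <= expR x) = (0 <= x).
Proof. by rewrite -[leLHS]expR0 ler_expR. Qed.

(** Both signs follow from 1 + y <= exp y, taken at y = - x and multiplied by exp x when x >= 0, and
    at y = x otherwise. *)
Lemma expR_sub1_le (x : R) : `|expR x - 1| <= `|x| * expR `|x|.
Proof.
have [x0|x0] := leP 0 x.
  rewrite (ger0_norm x0) ger0_norm ?subr_ge0 ?expR_ge1//.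
  have := expR_ge1Dx (- x); rewrite expRN => h.
  have := ler_wpM2r (expR_ge0 x) h.
  by rewrite mulVf ?gt_eqF ?expR_gt0// => ?; lra.
rewrite (ltr0_norm x0) ltr0_norm ?subr_lt0 ?expR_lt1//.
have := expR_ge1Dx x => h.
have : - x * 1 <= - x * expR (- x).
  by rewrite ler_pM2l ?oppr_gt0// ltW// expR_gt1 oppr_gt0.
lra.
Qed.

(** With G = 1 + 1 / a, a bound for |gamma|, this is (1 + G) exp(lambda + G): the first factor
    bounds (lambda s + G) exp(- lambda s), the second bounds exp |D|. *)
Definition increment_cst : R := (2 + a^-1) * expR (lambda + (1 + a^-1)).

Lemma increment_cst_ge1 : 1 <= increment_cst.
Proof.
have ai : 0 < a^-1 by rewrite invr_gt0.
rewrite -[leLHS]mulr1 ler_pM//; first by lra.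
by rewrite expR_ge1; move: lambda_gt0; lra.
Qed.

Lemma ln_increment_le (s h : R) : 0 < s -> 0 < h ->
  0 <= ln (s + h) - ln s <= h / s.
Proof.
move=> s0 h0; have sh : 0 < s + h by rewrite addr_gt0.
rewrite subr_ge0 ler_ln ?posrE// lerDl (ltW h0)/=.
rewrite -ln_div ?posrE// mulrDl mulfV ?gt_eqF//.
by apply: le_ln1Dx; apply: (lt_trans (ltrN10 _)); rewrite divr_gt0.
Qed.

(* With k(s) = exp (- lambda s + gamma ln s), the increment is k(s) (exp D - 1)
   for D = - lambda h + gamma (ln (s + h) - ln s) = O(h); the factor
   lambda + |gamma| / s in the bound on D is absorbed by exp (- lambda s). *)
Lemma tempered_power_increment_le (s h : R) : 0 < h -> h <= 1 -> h <= s ->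
  `|tempered_power gamma (s + h) - tempered_power gamma s|
    <= increment_cst * h * s `^ (gamma - 1).
Proof.
move=> h0 h1 hs; have s0 : 0 < s := lt_le_trans h0 hs.
have sh0 : 0 < s + h by rewrite addr_gt0.
have ai : 0 < a^-1 by rewrite invr_gt0.
set G := 1 + a^-1; have G0 : 0 < G by rewrite /G; lra.
have gG : `|gamma| <= G.
  have Aia : A^-1 <= a^-1 by rewrite lef_pV2.
  have Ai : 0 < A^-1 by rewrite invr_gt0.
  by rewrite ler_norml /gamma /G; move: H_gt0 H_lt1; lra.
pose D := - lambda * h + gamma * (ln (s + h) - ln s).
have Dh : `|D| <= (lambda + G / s) * h.
  apply: le_trans (ler_normD _ _) _; rewrite [leRHS]mulrDl lerD//.
    by rewrite mulNr normrN ger0_norm// mulr_ge0// ltW.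
  have /andP[l0 l1] := ln_increment_le s0 h0.
  by rewrite normrM mulrAC -mulrA ler_pM// ger0_norm.
(* Since h <= 1 and h <= s, the exponent D is bounded by a constant, which controls the factor exp
   |D| left by [expR_sub1_le]. *)
have DG : `|D| <= lambda + G.
  apply: le_trans Dh _; rewrite mulrDl lerD//.
    by rewrite ler_piMr// ltW.
  by rewrite mulrAC -mulrA ler_piMr ?(ltW G0)// ler_pdivrMr// mul1r.
have eD : tempered_power gamma (s + h) - tempered_power gamma s =
    expR (- lambda * s) * s `^ gamma * (expR D - 1).
  rewrite !tempered_powerE// /powR !gt_eqF// -!expRD mulrBr mulr1 -expRD.
  by congr (expR _ - _); rewrite /D; ring.
rewrite eD normrM ger0_norm ?mulr_ge0 ?expR_ge0 ?powR_ge0//.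
have sE : s `^ gamma = s * s `^ (gamma - 1).
  rewrite -[X in X * _]powRr1 ?ltW// -powRD; last first.
    by apply/implyP => _; rewrite gt_eqF.
  by congr (_ `^ _); ring.
have step : `|expR D - 1| <= (lambda + G / s) * h * expR (lambda + G).
  apply: le_trans (expR_sub1_le D) _.
  by rewrite ler_pM ?expR_ge0// ler_expR.
apply: le_trans (ler_wpM2l _ step) _; first by rewrite mulr_ge0 ?expR_ge0 ?powR_ge0.
(* Add exp(lambda s) >= 1 + lambda s and G exp(lambda s) >= G. *)
have lin : expR (- lambda * s) * (lambda * s + G) <= 1 + G.
  have ls0 : 0 < lambda * s by rewrite mulr_gt0.
  rewrite mulNr expRN mulrC ler_pdivrMr ?expR_gt0//.
  have := expR_ge1Dx (lambda * s) => e1.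
  have : G * 1 <= G * expR (lambda * s) by rewrite ler_pM2l// expR_ge1 ltW.
  by lra.
rewrite sE [leLHS](_ : _ = (expR (- lambda * s) * (lambda * s + G)) *
  (expR (lambda + G) * h * s `^ (gamma - 1))); last by field; rewrite gt_eqF.
rewrite /increment_cst (_ : 2 + a^-1 = 1 + G); last by rewrite /G; ring.
rewrite -/G [leRHS](_ : _ = (1 + G) * (expR (lambda + G) * h * s `^ (gamma - 1)));
  last by ring.
by rewrite ler_wpM2r// !mulr_ge0 ?expR_ge0 ?powR_ge0 ?(ltW h0).
Qed.

(** The increment bound is M r s ^ (- 1 / A) with r = h s ^ (- (1 - H)). Its power A is M ^ A r ^ A
    / s, and M >= 1, r <= 1 allow A to be replaced by 2 and by a respectively. *)
Lemma tempered_power_tail (s h : R) : 0 < h -> h <= 1 -> h <= s ->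
  `|tempered_power gamma (s + h) - tempered_power gamma s| `^ A
    <= increment_cst ^+ 2 * h `^ a * s `^ (- ((1 - H) * a) - 1).
Proof.
move=> h0 h1 hs; have s0 : 0 < s := lt_le_trans h0 hs.
move: increment_cst_ge1 (tempered_power_increment_le h0 h1 hs).
move: increment_cst => M M1 Mle; have M0 : 0 <= M by lra.
have H1 : 0 < 1 - H by rewrite subr_gt0.
have nz (x y z : R) : 0 < x -> (y + z == 0) ==> (x != 0).
  by move=> x0; apply/implyP => _; rewrite gt_eqF.
apply: (@le_trans _ _ ((M * h * s `^ (gamma - 1)) `^ A)).
  apply: ge0_ler_powR; rewrite ?nnegrE ?(ltW A_gt0)//.
    by rewrite mulr_ge0 ?powR_ge0// mulr_ge0// ltW.
pose r := h * s `^ (- (1 - H)).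
have r0 : 0 < r by rewrite mulr_gt0// powR_gt0.
(* From h <= h ^ (1 - H) <= s ^ (1 - H), by h <= 1 and h <= s. *)
have r1 : r <= 1.
  rewrite /r powRN ler_pdivrMr ?powR_gt0// mul1r.
  apply: (@le_trans _ _ (h `^ (1 - H))).
    by apply: ger1_powR; [rewrite h0|rewrite lerBlDr lerDl ltW].
  by apply: ge0_ler_powR => //; rewrite ?nnegrE ltW.
have -> : M * h * s `^ (gamma - 1) =
    M * (r * s `^ (- A^-1)).
  rewrite /r -!mulrA -powRD ?nz//; congr (_ * (_ * _ `^ _)).
  by rewrite /gamma; ring.
have rs0 : 0 <= r * s `^ (- A^-1) by exact: mulr_ge0 (ltW r0) (powR_ge0 _ _).
rewrite (powRM _ M0 rs0) (powRM _ (ltW r0) (powR_ge0 _ _)).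
rewrite -[X in _ * (_ * X)]powRrM mulNr mulVf ?gt_eqF//.
have -> : M ^+ 2 * h `^ a * s `^ (- ((1 - H) * a) - 1) =
    M ^+ 2 * (r `^ a * s `^ (- 1)).
  rewrite /r powRM ?powR_ge0 ?(ltW h0)// -powRrM -!mulrA -powRD ?nz//.
  by rewrite mulNr.
rewrite ler_pM ?mulr_ge0 ?powR_ge0//.
  rewrite -(powR_mulrn _ M0); apply: ler_powR => //; exact: le_trans b_le2.
by rewrite ler_wpM2r ?powR_ge0//; apply: ger_powR; rewrite ?r0.
Qed.

End tempered_power.

(** * Domination of the kernel increment and the upper bound for its modular *)

Section kernel_increment.
Context {R : realType} (H lambda a b : R) (alpha : R -> R).
Hypotheses (H_gt0 : 0 < H) (H_lt1 : H < 1) (lambda_gt0 : 0 < lambda)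
  (a_gt0 : 0 < a) (b_le2 : b <= 2) (malpha : measurable_fun setT alpha)
  (alphaab : forall x, a <= alpha x <= b).
Local Notation mu := (@lebesgue_measure R).

Let alpha_gt0 x : 0 < alpha x := exponent_gt0 a_gt0 alphaab x.

Definition kernel_increment (t v x : R) : R :=
  ltfmsm_kernel H lambda alpha t x - ltfmsm_kernel H lambda alpha v x.

(** The terms in - x, common to both times, cancel. *)
Lemma kernel_incrementE t v x : kernel_increment t v x =
  tempered_power lambda (H - (alpha x)^-1) (t - x) -
  tempered_power lambda (H - (alpha x)^-1) (v - x).
Proof.
by rewrite /kernel_increment /ltfmsm_kernel -/(tempered_power lambda _ (t - x))
  -/(tempered_power lambda _ (v - x)); ring.
Qed.

Lemma measurable_tempered_power_sub t :
  measurable_fun setT (fun x => tempered_power lambda (H - (alpha x)^-1) (t - x)).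
Proof.
have mpos : measurable_fun setT (fun x : R => pos_part (t - x)).
  by apply: measurable_maxr => //; exact: measurable_funB.
apply: measurable_funM.
  apply: (measurableT_comp (@measurable_expR R)).
  exact: measurable_funM.
apply: measurable_fun_ifT => //; first exact: measurable_fun_eqr.
apply: measurable_fun_powR_var => //; apply: measurable_funB => //.
rewrite (_ : (fun x => (alpha x)^-1) = (fun x => alpha x `^ (- 1))).
  exact: (measurableT_comp (measurable_powR (- 1))).
by apply/funext => x; rewrite powR_inv1 ?ltW.
Qed.

Lemma measurable_kernel_increment t v :
  measurable_fun setT (kernel_increment t v).
Proof.
rewrite (_ : kernel_increment t v = fun x =>
  tempered_power lambda (H - (alpha x)^-1) (t - x) -
  tempered_power lambda (H - (alpha x)^-1) (v - x)); last first.
  by apply/funext => x; rewrite kernel_incrementE.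
by apply: measurable_funB; exact: measurable_tempered_power_sub.
Qed.

Context (v h : R).
Hypotheses (h_gt0 : 0 < h) (h_le1 : h <= 1).

Let M := increment_cst lambda a.
(** Majorants around the singularities z = v + h and z = v, and in the far past. [S1] has length 2
    h, so that it also covers the points of [S2], where both terms are present. *)
Let near_dom z x : R := 4 * (z - x) `^ (H * a - 1).
Let far_dom x : R := M ^+ 2 * h `^ a * (v - x) `^ (- ((1 - H) * a) - 1).
Let S1 := `[v + h - 2 * h, v + h[%classic.
Let S2 := `[v - h, v[%classic.
Let S3 := `]-oo, v - h]%classic.

(** Four regions: both terms vanish for x >= v + h; only the first survives on [v, v +
    h[; both are near their singularities on ]v - h, v[; the tail bound applies for x <= v - h. *)
Lemma kernel_increment_dom (x : R) :
  `|kernel_increment (v + h) v x| `^ alpha x <=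
  (near_dom (v + h) \_ S1) x + (near_dom v \_ S2) x + (far_dom \_ S3) x.
Proof.
have near0 z y : 0 <= near_dom z y by rewrite mulr_ge0// powR_ge0.
have far0 y : 0 <= far_dom y.
  by rewrite mulr_ge0 ?powR_ge0// mulr_ge0 ?powR_ge0// sqr_ge0.
have n1 : 0 <= (near_dom (v + h) \_ S1) x by rewrite patchE; case: ifPn.
have n2 : 0 <= (near_dom v \_ S2) x by rewrite patchE; case: ifPn.
have n3 : 0 <= (far_dom \_ S3) x by rewrite patchE; case: ifPn.
have h0 := h_gt0; have h1 := h_le1.
have /andP[aA Ab] := alphaab x; have A0 := alpha_gt0 x.
have near (z s : R) : 0 < s -> s <= 2 -> s = z - x ->
    tempered_power lambda (H - (alpha x)^-1) s `^ alpha x <= near_dom z x.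
  move=> s0 s2 sE; rewrite /near_dom -sE.
  by have := tempered_power_upper H_gt0 H_lt1 lambda_gt0 a_gt0 aA Ab b_le2 s0 s2.
rewrite kernel_incrementE.
have [xt|xt] := leP (v + h) x.
  rewrite !tempered_power0; [|lra|lra].
  by rewrite subrr normr0 powR0 ?gt_eqF// !addr_ge0.
have [xv|xv] := leP v x.
  rewrite [X in _ - X]tempered_power0; last by lra.
  rewrite subr0 ger0_norm ?tempered_power_ge0//.
  have -> : (near_dom (v + h) \_ S1) x = near_dom (v + h) x.
    by rewrite patchE mem_set// /S1 /S2 /S3 /= in_itv/=; lra.
  have N : tempered_power lambda (H - (alpha x)^-1) (v + h - x) `^ alpha x
    <= near_dom (v + h) x by apply: near => //; lra.
  lra.
have [xh|xh] := leP x (v - h).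
  have -> : (far_dom \_ S3) x = far_dom x.
    by rewrite patchE mem_set// /S1 /S2 /S3 /= in_itv/=.
  rewrite (_ : v + h - x = (v - x) + h); last by ring.
  apply: le_trans (tempered_power_tail H_gt0 H_lt1 lambda_gt0 a_gt0 aA Ab b_le2
    h_gt0 h_le1 _) _; first by lra.
  by rewrite lerDr addr_ge0.
have -> : (near_dom (v + h) \_ S1) x = near_dom (v + h) x.
  by rewrite patchE mem_set// /S1 /S2 /S3 /= in_itv/=; lra.
have -> : (near_dom v \_ S2) x = near_dom v x.
  by rewrite patchE mem_set// /S1 /S2 /S3 /= in_itv/=; lra.
have : tempered_power lambda (H - (alpha x)^-1) (v - x) `^ alpha x
  <= near_dom v x by apply: near => //; lra.
have : tempered_power lambda (H - (alpha x)^-1) (v + h - x) `^ alpha x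
  <= near_dom (v + h) x by apply: near => //; lra.
move: (tempered_power_ge0 lambda (H - (alpha x)^-1) (v + h - x)).
move: (tempered_power_ge0 lambda (H - (alpha x)^-1) (v - x)).
move: (tempered_power _ _ (v + h - x)) (tempered_power _ _ (v - x)) => k1 k2.
move=> k20 k10 N1 N2; have N0 := near0 v x; have N0' := near0 (v + h) x.
move: (near_dom v x) (near_dom (v + h) x) N1 N2 N0 N0' => d2 d1 N1 N2 N0 N0'.
move: ((far_dom \_ S3) x) n3 => d3 n3; clear n1 n2 near0 near far0.
(* Both terms are nonnegative, so |k1 - k2| is at most the larger one and its power costs no extra
   constant. *)
have [k12|k12] := leP k2 k1.
  have : `|k1 - k2| `^ alpha x <= k1 `^ alpha x.
    apply: ge0_ler_powR; rewrite ?nnegrE ?(ltW A0)//.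
    by rewrite ger0_norm; lra.
  lra.
have : `|k1 - k2| `^ alpha x <= k2 `^ alpha x.
  apply: ge0_ler_powR; rewrite ?nnegrE ?(ltW A0)//.
  by rewrite ltr0_norm; lra.
lra.
Qed.

(** The integrals of the three majorants over [S1], [S2] and [S3], each divided by h ^ (H a). *)
Definition upper_cst : R :=
  4 * (2 `^ (H * a) / (H * a)) + 4 / (H * a) + M ^+ 2 / ((1 - H) * a).

Lemma modular_kernel_increment_le :
  (modular alpha (kernel_increment (v + h) v) <= (upper_cst * h `^ (H * a))%:E)%E.
Proof.
have Ha : 0 < H * a by rewrite mulr_gt0.
have H1a : 0 < (1 - H) * a by rewrite mulr_gt0// subr_gt0.
have near0 z y : 0 <= near_dom z y by rewrite mulr_ge0// powR_ge0.
have c0 : 0 <= M ^+ 2 * h `^ a by rewrite mulr_ge0 ?powR_ge0// sqr_ge0.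
have far0 y : 0 <= far_dom y by rewrite mulr_ge0 ?powR_ge0.
have mnear z D : measurable_fun D (fun x => (near_dom z x)%:E).
  under eq_fun do rewrite EFinM.
  by apply: measurable_funeM; exact: measurable_powR_sub.
have mfar D : measurable_fun D (fun x => (far_dom x)%:E).
  under eq_fun do rewrite EFinM.
  by apply: measurable_funeM; exact: measurable_powR_sub.
have mS1 : measurable S1 by exact: measurable_itv.
have mS2 : measurable S2 by exact: measurable_itv.
have mS3 : measurable S3 by exact: measurable_itv.
have intZ k z p D : 0 <= k -> measurable D ->
    (\int[mu]_(x in D) (k * (z - x) `^ p)%:E =
     k%:E * \int[mu]_(x in D) ((z - x) `^ p)%:E)%E.
  move=> k0 mD; under eq_integral do rewrite EFinM.
  apply: ge0_integralZl_EFin => //; last exact: measurable_powR_sub.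
  by move=> x _; rewrite lee_fin powR_ge0.
have I1 : (\int[mu]_(x in S1) (near_dom (v + h) x)%:E <=
    (4 * ((2 * h) `^ (H * a) / (H * a)))%:E)%E.
  rewrite intZ// [leRHS]EFinM lee_pmul2l//; apply: integral_powR_sub_left_le => //.
  by rewrite mulr_gt0.
have I2 : (\int[mu]_(x in S2) (near_dom v x)%:E <=
    (4 * (h `^ (H * a) / (H * a)))%:E)%E.
  by rewrite intZ// [leRHS]EFinM lee_pmul2l//; apply: integral_powR_sub_left_le.
have I3 : (\int[mu]_(x in S3) (far_dom x)%:E <=
    (M ^+ 2 * h `^ a * (h `^ (- ((1 - H) * a)) / ((1 - H) * a)))%:E)%E.
  rewrite intZ// [leRHS]EFinM lee_wpmul2l ?lee_fin//.
  exact: integral_powR_sub_tail_le.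
have K1 : (2 * h) `^ (H * a) = 2 `^ (H * a) * h `^ (H * a).
  by rewrite powRM// ltW.
(* The tail thus has the same order in h as the two singular parts. *)
have K3 : h `^ a * h `^ (- ((1 - H) * a)) = h `^ (H * a).
  rewrite -powRD; first by congr (_ `^ _); ring.
  by apply/implyP => _; rewrite gt_eqF.
have intE (f : R -> R) D : (\int[mu]_(x in D) (f x)%:E = \int[mu]_x ((f \_ D) x)%:E)%E.
  by rewrite integral_mkcond -[X in X \_ _]/(EFin \o f) restrict_EFin.
have mE (f : R -> R) D : measurable D -> measurable_fun D (fun x => (f x)%:E) ->
    measurable_fun setT (fun x => ((f \_ D) x)%:E).
  move=> mD /measurable_EFinP mf; apply/measurable_EFinP.
  exact: (measurable_restrictT f mD).1 mf.
have E0 (f : R -> R) D x : (forall y, 0 <= f y) -> (0 <= ((f \_ D) x)%:E)%E.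
  by move=> f0; rewrite lee_fin patchE; case: ifPn.
apply: (@le_trans _ _ (\int[mu]_x (((near_dom (v + h) \_ S1) x)%:E +
    ((near_dom v \_ S2) x)%:E + ((far_dom \_ S3) x)%:E))%E).
  apply: ge0_le_integral => //.
  - exact: (measurable_modular_integrand malpha (measurable_kernel_increment _ _)).
  - apply: emeasurable_funD; last exact: (mE _ _ mS3 (mfar _)).
    exact: emeasurable_funD (mE _ _ mS1 (mnear _ _)) (mE _ _ mS2 (mnear _ _)).
  - by move=> x _; rewrite -!EFinD lee_fin; exact: kernel_increment_dom.
rewrite ge0_integralD//; last 4 first.
- by move=> x _; rewrite adde_ge0 ?E0.
- exact: emeasurable_funD (mE _ _ mS1 (mnear _ _)) (mE _ _ mS2 (mnear _ _)).
- by move=> x _; exact: E0.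
- exact: mE _ _ mS3 (mfar _).
rewrite ge0_integralD//; last 4 first.
- by move=> x _; exact: E0.
- exact: mE _ _ mS1 (mnear _ _).
- by move=> x _; exact: E0.
- exact: mE _ _ mS2 (mnear _ _).
rewrite -!intE.
apply: le_trans (leeD (leeD I1 I2) I3) _.
rewrite -!EFinD lee_fin K1 /upper_cst.
rewrite -(mulrA (M ^+ 2)) (mulrA (h `^ a)) K3.
rewrite le_eqVlt; apply/orP; left; apply/eqP; field.
by apply/and3P; split; rewrite gt_eqF// subr_gt0.
Qed.

End kernel_increment.

(** * The two test values of y and the resulting bounds on the quasi norm *)

Section kernel_increment_quasi_norm.
Context {R : realType} (H lambda a b : R).
Hypotheses (H_gt0 : 0 < H) (H_lt1 : H < 1) (lambda_gt0 : 0 < lambda)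
  (a_gt0 : 0 < a) (a_le_b : a <= b) (b_le2 : b <= 2).
Local Notation mu := (@lebesgue_measure R).

Let b_gt0 : 0 < b := lt_le_trans a_gt0 a_le_b.
Let K : R := upper_cst H lambda a.

Lemma upper_cst_ge0 : 0 <= upper_cst H lambda a.
Proof.
have Ha : 0 < H * a by rewrite mulr_gt0.
have H1a : 0 < (1 - H) * a by rewrite mulr_gt0// subr_gt0.
rewrite /upper_cst !addr_ge0 ?divr_ge0 ?sqr_ge0 ?(ltW Ha) ?(ltW H1a)//.
by rewrite mulr_ge0// divr_ge0 ?powR_ge0 ?(ltW Ha).
Qed.

(** Chosen so that C ^ a = 1 + K with C >= 1; the added 1 makes the final ratio K / (1 + K) strictly
    less than 1. *)
Definition quasi_norm_upper_cst : R := (1 + K) `^ a^-1.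

(** Chosen so that c ^ a is a quarter of exp(- 2 lambda) 2 ^ (- H b), the constant in the lower
    bound of the integrand on [v, v + h / 2]. *)
Definition quasi_norm_lower_cst : R :=
  (expR (- (2 * lambda)) * 2^-1 `^ (H * b) / 4) `^ a^-1.

Lemma quasi_norm_upper_cst_gt0 : 0 < quasi_norm_upper_cst.
Proof. by rewrite powR_gt0// ltr_pwDl// upper_cst_ge0. Qed.

Lemma quasi_norm_lower_cst_gt0 : 0 < quasi_norm_lower_cst.
Proof.
by rewrite powR_gt0// divr_gt0// mulr_gt0 ?expR_gt0// powR_gt0// invr_gt0.
Qed.

Context (alpha : R -> R).
Hypotheses (malpha : measurable_fun setT alpha)
  (alphaab : forall x, a <= alpha x <= b).
Let alpha_gt0 x : 0 < alpha x := exponent_gt0 a_gt0 alphaab x.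

Context (v h : R).
Hypotheses (h_gt0 : 0 < h) (h_le1 : h <= 1).
Local Notation g := (kernel_increment H lambda alpha (v + h) v).

Let mg : measurable_fun setT g := measurable_kernel_increment H lambda
  a_gt0 malpha alphaab (v + h) v.

Lemma modular_kernel_increment_upper :
  (modular alpha (fun x => g x / (quasi_norm_upper_cst * h `^ (H * a / b)))%R < 1)%E.
Proof.
set C := quasi_norm_upper_cst; set y := C * _.
have C0 : 0 < C := quasi_norm_upper_cst_gt0.
have K0 : 0 <= K := upper_cst_ge0.
have K10 : 0 <= 1 + K by rewrite addr_ge0.
have hp p : 0 < h `^ p by rewrite powR_gt0.
have y0 : 0 < y by rewrite mulr_gt0.
have C1 : 1 <= C.
  by rewrite -(powRr0 (1 + K)) /C; apply: ler_powR; rewrite ?lerDl// invr_ge0 ltW.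
have Ca : C `^ a = 1 + K.
  by rewrite -powRrM mulVf ?gt_eqF// powRr1.
(* C >= 1 gives C ^ A >= C ^ a, and h <= 1 with A / b <= 1 gives h ^ (H a A / b) >= h ^ (H a). *)
have ypow A : a <= A -> A <= b -> (1 + K) * h `^ (H * a) <= y `^ A.
  move=> aA Ab; have A0 : 0 < A := lt_le_trans a_gt0 aA.
  rewrite powRM ?powR_ge0 ?(ltW C0)// ler_pM ?powR_ge0//.
    by rewrite -Ca; apply: ler_powR.
  rewrite -powRrM; apply: ger_powR; first by rewrite h_gt0.
  by rewrite mulrAC ler_pdivrMr// ler_pM2l// mulr_gt0.
have q0 : 0 < (1 + K) * h `^ (H * a) by rewrite mulr_gt0// ltr_pwDl.
have mmg := measurable_modular_integrand malpha mg.
apply: (@le_lt_trans _ _ (((1 + K) * h `^ (H * a))^-1%:E * modular alpha g)%E).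
  rewrite /modular -ge0_integralZl_EFin//; last by rewrite invr_ge0 ltW.
  apply: ge0_le_integral => //.
  - apply: (measurable_modular_integrand malpha (f := fun x => g x / y)).
    exact: measurable_funM.
  - by apply: measurable_funeM; exact: mmg.
  move=> x _; rewrite -EFinM lee_fin normrM powRM//.
  rewrite mulrC ler_wpM2r ?powR_ge0//.
  have /andP[aA Ab] := alphaab x.
  rewrite gtr0_norm ?invr_gt0// -(powR_inv1 (ltW y0)) -powRrM mulN1r powRN.
  rewrite lef_pV2 ?posrE ?powR_gt0//.
  exact: ypow.
apply: (@le_lt_trans _ _ (((1 + K) * h `^ (H * a))^-1 * (K * h `^ (H * a)))%:E).
  rewrite [leRHS]EFinM lee_wpmul2l ?lee_fin ?invr_ge0 ?(ltW q0)//.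
  exact: (modular_kernel_increment_le H_gt0 H_lt1 lambda_gt0 a_gt0 b_le2 malpha alphaab v h_gt0 h_le1).
rewrite lte_fin ltr_pdivrMl// mulr1 ltr_pM2r//; move: K0; lra.
Qed.

Lemma modular_kernel_increment_lower :
  (1 < modular alpha (fun x => g x / (quasi_norm_lower_cst * h `^ (H * b / a)))%R)%E.
Proof.
set c := quasi_norm_lower_cst; set y := c * _.
have c0 : 0 < c := quasi_norm_lower_cst_gt0.
have hp p : 0 < h `^ p by rewrite powR_gt0.
have y0 : 0 < y by rewrite mulr_gt0.
pose L := expR (- (2 * lambda)) * 2^-1 `^ (H * b).
have L0 : 0 < L by rewrite mulr_gt0 ?expR_gt0// powR_gt0// invr_gt0.
have Hb : 0 < H * b by rewrite mulr_gt0.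
have half01 : 0 < (2^-1 : R) <= 1 by lra.
have L1 : L <= 1.
  rewrite -[leRHS]mulr1 ler_pM ?expR_ge0 ?powR_ge0//.
    by rewrite expR_le1 oppr_le0 mulr_ge0// ltW.
  by rewrite -[leRHS](powRr0 (2^-1)); apply: ger_powR => //; exact: ltW.
have ca : c `^ a = L / 4.
  by rewrite -powRrM mulVf ?gt_eqF// powRr1// divr_ge0// ltW.
have ya : y `^ a = L / 4 * h `^ (H * b).
  by rewrite powRM ?powR_ge0 ?(ltW c0)// ca -powRrM divfK ?gt_eqF.
(* With y <= 1, the power y ^ (- alpha(x)) is at least y ^ (- a), whose value is explicit by
   [ya]. *)
have y1 : y <= 1.
  have c1 : c <= 1.
    rewrite -[leRHS](congr1 (fun f => f a^-1) (powR1 R)).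
    apply: ge0_ler_powR; rewrite ?nnegrE ?invr_ge0 ?(ltW a_gt0)//.
    by rewrite -/L ler_pdivrMr//; move: L1; lra.
  rewrite -[leRHS]mulr1 ler_pM ?powR_ge0 ?(ltW c0)//.
  rewrite -(powRr0 h); apply: ger_powR; first by rewrite h_gt0.
  by rewrite divr_ge0 ?ltW.
pose S := `[v, v + h / 2]%classic.
have mS : measurable S by exact: measurable_itv.
have gm : measurable_fun setT (fun x => g x / y) by exact: measurable_funM.
have mmg := measurable_modular_integrand malpha gm.
(* The integrand will be shown to be at least 4 / h on [S], of length h / 2, which gives 2 > 1. *)
have I : (1 < \int[mu]_(x in S) (cst (4 / h)%:E x))%E.
  rewrite integral_cst//= /S lebesgue_measure_itv/= lte_fin ifT; last first.
    by rewrite ltrDl divr_gt0.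
  rewrite -EFinB -EFinM lte_fin (_ : _ * _ = 2); first by lra.
  by field; rewrite gt_eqF.
apply: (lt_le_trans I).
apply: (@le_trans _ _ (\int[mu]_(x in S) (`|g x / y| `^ alpha x)%:E)%E).
  apply: ge0_le_integral => //.
  - by move=> x _; rewrite lee_fin divr_ge0// ltW.
  - exact: measurable_funTS.
  move=> x; rewrite /S/= in_itv/= => /andP[vx xv].
  rewrite lee_fin; have /andP[aA Ab] := alphaab x; have A0 := alpha_gt0 x.
  pose s := v + h - x.
  have h0 := h_gt0; have h1 := h_le1.
  have s0 : 0 < s by rewrite /s; lra.
  have s1 : s <= 1 by rewrite /s; lra.
  have sh : h / 2 <= s by rewrite /s; lra.
  have sh' : s <= h by rewrite /s; lra.
  rewrite kernel_incrementE -/s [X in _ - X]tempered_power0; last by rewrite subr_le0.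
  rewrite subr0 ger0_norm; last by rewrite divr_ge0 ?tempered_power_ge0// ltW.
  rewrite powRM ?tempered_power_ge0 ?invr_ge0 ?(ltW y0)//.
  have low := tempered_power_lower H_gt0 lambda_gt0 a_gt0 aA Ab b_le2 s0 s1.
  (* The sign of H b - 1 is not known, so the power is split: s >= h / 2 serves s ^ (H b) and s <= h
     serves 1 / s. *)
  have sp : 2^-1 `^ (H * b) * h `^ (H * b) / h <= s `^ (H * b - 1).
    rewrite powRB; last by apply/implyP => _; rewrite gt_eqF.
    rewrite powRr1 ?(ltW s0)// ler_pM ?mulr_ge0 ?powR_ge0 ?invr_ge0 ?(ltW h0)//.
      rewrite -powRM ?(ltW h0)//.
      apply: ge0_ler_powR; rewrite ?nnegrE ?(ltW Hb) ?(ltW s0)//.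
        by rewrite mulr_ge0 ?(ltW h0)//.
      by rewrite mulrC.
    by rewrite lef_pV2.
  have yp : (y `^ a)^-1 <= y^-1 `^ alpha x.
    rewrite -(powR_inv1 (ltW y0)) -powRrM mulN1r powRN.
    rewrite lef_pV2 ?posrE ?powR_gt0//; apply: ger_powR => //.
    by rewrite y0.
  rewrite (_ : 4 / h = expR (- (2 * lambda)) *
    (2^-1 `^ (H * b) * h `^ (H * b) / h) * (y `^ a)^-1); last first.
    rewrite ya /L; field.
    by rewrite !gt_eqF ?expR_gt0 ?powR_gt0 ?invr_gt0.
  apply: ler_pM yp; rewrite ?invr_ge0 ?powR_ge0//.
    by rewrite mulr_ge0 ?expR_ge0// !mulr_ge0 ?powR_ge0// invr_ge0 ltW.
  by apply: le_trans low; rewrite ler_wpM2l ?expR_ge0.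
by apply: ge0_subset_integral => // x _; rewrite lee_fin powR_ge0.
Qed.

Lemma integrand_quasi_norm_kernel_increment :
  [/\ measurable_fun setT g, (modular alpha g < +oo)%E &
    quasi_norm_lower_cst * h `^ (H * b / a) <= integrand_quasi_norm alpha g
      <= quasi_norm_upper_cst * h `^ (H * a / b)].
Proof.
split; first exact: mg.
  apply: le_lt_trans (modular_kernel_increment_le H_gt0 H_lt1 lambda_gt0 a_gt0
    b_le2 malpha alphaab v h_gt0 h_le1) _; exact: ltry.
apply: (integrand_quasi_norm_itv malpha a_gt0 alphaab mg).
- by rewrite mulr_gt0 ?quasi_norm_lower_cst_gt0 ?powR_gt0.
- by rewrite mulr_gt0 ?quasi_norm_upper_cst_gt0 ?powR_gt0.
- exact: modular_kernel_increment_lower.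
- exact: modular_kernel_increment_upper.
Qed.

End kernel_increment_quasi_norm.

(** * Sign change, the zero integrand, and the two-sided estimate for all t and v *)

Lemma modularN {R : realType} (alpha f : R -> R) :
  modular alpha (fun x => - f x) = modular alpha f.
Proof. by rewrite /modular; under eq_integral do rewrite normrN. Qed.

Lemma integrand_quasi_normN {R : realType} (alpha f : R -> R) :
  integrand_quasi_norm alpha (fun x => - f x) = integrand_quasi_norm alpha f.
Proof.
congr xget; apply/seteqP.
suff e y : modular alpha (fun x => - f x / y) = modular alpha (fun x => f x / y).
  by split => y /=; rewrite e.
by rewrite -modularN; congr modular; apply/funext => x; rewrite mulNr opprK.
Qed.

Lemma modular0 {R : realType} (alpha : R -> R) : (forall x, 0 < alpha x) ->
  modular alpha (fun=> 0) = 0%E.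
Proof.
move=> alpha0; rewrite /modular; apply: integral0_eq => x _.
by rewrite normr0 powR0// gt_eqF.
Qed.

(** The modular of 0 / y is 0 and never 1, so [xget] returns its default 0. *)
Lemma integrand_quasi_norm0 {R : realType} (alpha : R -> R) :
  (forall x, 0 < alpha x) -> integrand_quasi_norm alpha (fun=> 0) = 0.
Proof.
move=> alpha0; apply: xgetPN => y [y0].
under [in X in modular _ X]eq_fun do rewrite mul0r.
by rewrite modular0// => /eqP; rewrite eq_sym onee_eq0.
Qed.

Theorem proposition16 (R : realType) (a b H lambda : R)
    (ha : 0 < a) (hab : a <= b) (hb : b <= 2)
    (hH0 : 0 < H) (hH1 : H < 1) (hlambda : 0 < lambda) :
  exists c C : R, [/\ 0 < c, 0 < C &
    forall (alpha : R -> R),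
      continuous alpha -> (forall x : R, a <= alpha x <= b) ->
    forall (d : measure_display) (Omega : measurableType d)
      (P : probability Omega R) (X : R -> {RV P >-> R}),
      is_ltfmsm H lambda alpha X ->
    forall t v : R, `|t - v| <= 1 ->
      c * `|t - v| `^ (H * b / a) <= quasi_norm P alpha (X t \- X v)
        <= C * `|t - v| `^ (H * a / b)].
Proof.
exists (quasi_norm_lower_cst H lambda a b), (quasi_norm_upper_cst H lambda a).
split; [exact: quasi_norm_lower_cst_gt0|exact: quasi_norm_upper_cst_gt0|].
move=> alpha calpha alphaab d Omega P X HX t v tv1.
have b0 : 0 < b := lt_le_trans ha hab.
have malpha := continuous_measurable_fun calpha.
pose g := kernel_increment H lambda alpha t v.
suff [mg fing qg] : [/\ measurable_fun setT g, (modular alpha g < +oo)%E &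
    quasi_norm_lower_cst H lambda a b * `|t - v| `^ (H * b / a)
      <= integrand_quasi_norm alpha g
      <= quasi_norm_upper_cst H lambda a * `|t - v| `^ (H * a / b)].
  by rewrite (quasi_norm_integrand (ltfmsm_increment_integral HX mg fing)).
(* The estimate for v + h with h > 0 settles t > v; for t < v the times are exchanged and the
   integrand changes sign; for t = v all three members are 0. *)
have [tv|vt|tv] := ltgtP t v.
- have h0 : 0 < v - t by rewrite subr_gt0.
  have h1 : v - t <= 1 by rewrite -(gtr0_norm h0) distrC.
  have := integrand_quasi_norm_kernel_increment hH0 hH1 hlambda ha hab hb
    malpha alphaab t h0 h1.
  rewrite subrKC distrC (gtr0_norm h0).
  rewrite (_ : kernel_increment H lambda alpha v t = fun x => - g x).
    rewrite modularN integrand_quasi_normN => -[mg fing qg]; split => //.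
    exact: (measurable_kernel_increment H lambda ha malpha alphaab t v).
  by apply/funext => x; rewrite [RHS]opprB.
- have h0 : 0 < t - v by rewrite subr_gt0.
  have h1 : t - v <= 1 by rewrite -(gtr0_norm h0).
  have := integrand_quasi_norm_kernel_increment hH0 hH1 hlambda ha hab hb
    malpha alphaab v h0 h1.
  by rewrite subrKC (gtr0_norm h0).
have alpha0 x : 0 < alpha x := exponent_gt0 ha alphaab x.
have g0 : g = fun=> 0.
  by apply/funext => x; rewrite /g /kernel_increment tv subrr.
rewrite g0 modular0// integrand_quasi_norm0// tv subrr normr0; split => //.
by rewrite !powR0 ?mulr0 ?lexx// gt_eqF// divr_gt0// mulr_gt0.
Qed.
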